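(* Let $n\ge1$. The density function $\Lambda\mapsto\delta(\mathcal{B}(\Lambda))=\|\chi_{\mathcal{B}(\Lambda)}\|_1$ is continuous on $(\mathcal{UD},D)$ and locally constant.
   Context: $B(c,t)$ (resp. $\overset{\circ}{B}(c,t)$) is the closed (resp. open) ball of $\mathbb{R}^n$ with center $c$ and radius $t$, and $B=B(0,1/2)$. $\mathcal{UD}$ is the set of all uniformly discrete subsets of $\mathbb{R}^n$ of constant $1$, i.e. subsets $\Lambda$ with $\|x-y\|\ge 1$ for all distinct $x,y\in\Lambda$ (the empty set and finite sets are included). For $\Lambda\in\mathcal{UD}$, $\mathcal{B}(\Lambda)=\{\lambda+B:\lambda\in\Lambda\}$, $\chi_{\mathcal{B}(\Lambda)}$ is the characteristic function of the union of these balls, and $$\delta(\mathcal{B}(\Lambda))=\limsup_{T\to+\infty}\frac{\mathrm{vol}\big((\bigcup_{\lambda\in\Lambda}(\lambda+B))\cap B(0,T)\big)}{\mathrm{vol}(B(0,T))},\qquad \|g\|_1=\limsup_{t\to+\infty}\frac{1}{\mathrm{vol}(tB)}\int_{tB}|g(x)|\,dx .$$ Construction of the metric $D$. Fix a continuous function $f:\mathbb{R}^n\to[0,1]$ with compact support in $B(0,1)$ such that $f(0)=1$; $f(\rho(t))=f(t)$ for all $t\in\mathbb{R}^n$ and $\rho\in O(n,\mathbb{R})$; and $f(t)\le\frac{1/2+\|\lambda-t/2\|}{1/2+\|\lambda\|}$ for all $t\in B(0,1)$ and $\lambda\in\mathbb{R}^n$ (for instance $f(t)=1-2\|t\|$ for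 $t\in B(0,1/2)$ and $f(t)=0$ elsewhere). Let $\mathcal{E}$ be the set of pairs $(P,E)$ with $P$ a countable subset of $\mathbb{R}^n$ and $E$ a countable subset of $(0,1/2)$. For $(P,E)\in\mathcal{E}$ let $\mathcal{B}_{(P,E)}$ be the set of all finite collections $$\mathcal{B}_m=\{\overset{\circ}{B}(c_1^{(m)},\epsilon_1^{(m)}),\dots,\overset{\circ}{B}(c_{i_m}^{(m)},\epsilon_{i_m}^{(m)})\}$$ of open balls with $c_q^{(m)}\in P$ and $\epsilon_q^{(m)}\in E$ for all $q$, such that $\|c_q^{(m)}-c_k^{(m)}\|\ge1$ for any two distinct balls of the collection. For $\Lambda\in\mathcal{UD}$ put $$\phi_{\mathcal{B}_m}(\Lambda)=\sum_{\overset{\circ}{B}(c,\epsilon)\in\mathcal{B}_m}\ \sum_{x\in\Lambda}\epsilon\, f\Big(\frac{x-c}{\epsilon}\Big),\qquad \phi_{\mathcal{B}_m}(\emptyset)=0 .$$ For $\alpha\in\mathbb{R}^n$ and $(P,E)\in\mathcal{E}$ put $$d_{\alpha,(P,E)}(\Lambda,\Lambda')=\sup_{\mathcal{B}_m\in\mathcal{B}_{(P,E)}}\frac{|\phi_{\mathcal{B}_m}(\Lambda)-\phi_{\mathcal{B}_m}(\Lambda')|}{\frac12+\|\alpha\|+\|\alpha-c_1^{(m)}\|+\dots+\|\alpha-c_{i_m}^{(m)}\|}.$$ Then $d:=\sup_{\alpha\in\mathbb{R}^n,\,(P,E)\in\mathcal{E}}d_{\alpha,(P,E)}$ is a metric on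 $\mathcal{UD}$ with values in $[0,1]$. For $x\in\mathbb{R}^n$ put $d_x(\Lambda,\Lambda')=d(\Lambda-x,\Lambda'-x)$, and $$D(\Lambda,\Lambda')=\sup_{x\in\mathbb{R}^n}d_x(\Lambda,\Lambda'),\qquad \Lambda,\Lambda'\in\mathcal{UD}.$$ *)

(* Defs.v *)
From HB Require Import structures.
From mathcomp Require Import all_boot all_order all_algebra.
From mathcomp Require Import finmap.
From mathcomp Require Import all_classical all_reals all_analysis.

Set Implicit Arguments.
Unset Strict Implicit.
Unset Printing Implicit Defensive.

Import Order.TTheory GRing.Theory Num.Theory.
Import numFieldNormedType.Exports.

Local Open Scope classical_set_scope.
Local Open Scope ring_scope.

Definition measure_rV_display : measure_display.
Proof. exact: default_measure_display. Qed.

Section measurable_rV.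
Context (R : realType) (n : nat).

Let coors : 'I_n -> 'rV[R]_n -> measurableTypeR R := fun i v => v ord0 i.

Let rV_set0 : g_sigma_preimage coors set0.
Proof. exact: sigma_algebra0. Qed.

Let rV_setC A : g_sigma_preimage coors A -> g_sigma_preimage coors (~` A).
Proof. exact: sigma_algebraC. Qed.

Let rV_bigcup (F : (set 'rV[R]_n)^nat) : (forall i, g_sigma_preimage coors (F i)) ->
  g_sigma_preimage coors (\bigcup_i (F i)).
Proof. exact: sigma_algebra_bigcup. Qed.

(* The sigma-algebra generated by the coordinates, i.e. the Borel sets;
   the library does the same for [n.-tuple T]. *)
HB.instance Definition _ := @isMeasurable.Build measure_rV_display
  'rV[R]_n (g_sigma_preimage coors) rV_set0 rV_setC rV_bigcup.

End measurable_rV.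

Section lebesgue_rV.
Context (R : realType).

Definition cons_rV (n : nat) (xv : measurableTypeR R * 'rV[R]_n) : 'rV[R]_n.+1 :=
  \row_(i < n.+1) (if unlift ord0 i is Some j then xv.2 ord0 j else xv.1).

Lemma measurable_coord_rV (n : nat) (i : 'I_n) :
  measurable_fun [set: 'rV[R]_n] (fun v => v ord0 i : measurableTypeR R).
Proof.
move=> _ Y mY; rewrite setTI; apply: sub_sigma_algebra => /=.
rewrite -bigcup_seq/=; exists i => /=; first by rewrite mem_index_enum.
by exists Y => //; rewrite setTI.
Qed.

Lemma measurable_fun_rVP d (T : measurableType d) (n : nat) (f : T -> 'rV[R]_n) :
  (forall i, measurable_fun [set: T] (fun x => f x ord0 i : measurableTypeR R)) ->
  measurable_fun [set: T] f.
Proof.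
move=> mf; apply: (@measurability _ _ _ _ _ _
  (\big[setU/set0]_(i < n) preimage_set_system setT
     (fun v : 'rV[R]_n => v ord0 i : measurableTypeR R) measurable)) => //.
move=> _ [A + <-].
rewrite -bigcup_seq => -[/= i _ [B mB <-]].
by rewrite setTI; exact: (mf i measurableT B mB).
Qed.

Lemma measurable_cons_rV (n : nat) : measurable_fun setT (@cons_rV n).
Proof.
apply: measurable_fun_rVP => i.
case: (unliftP ord0 i) => [j|] ->.
  apply: (eq_measurable_fun (fun x : measurableTypeR R * 'rV[R]_n =>
     x.2 ord0 j : measurableTypeR R)).
    by move=> x _; rewrite mxE liftK.
  exact: (measurableT_comp (measurable_coord_rV j) measurable_snd).
apply: (eq_measurable_fun (fun x : measurableTypeR R * 'rV[R]_n => x.1)).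
  by move=> x _; rewrite mxE unlift_none.
exact: measurable_fst.
Qed.

HB.instance Definition _ (n : nat) :=
  isMeasurableFun.Build _ _ _ _ (@cons_rV n) (@measurable_cons_rV n).

Local Open Scope ereal_scope.

Section lebesgue_consr.
Variables (n : nat) (m : {measure set 'rV[R]_n -> \bar R}).

Definition lebesgue_consr : set 'rV[R]_n.+1 -> \bar R :=
  pushforward (@lebesgue_measure R \x^ m) (@cons_rV n).

Let lebesgue_consr0 : lebesgue_consr set0 = 0.
Proof. exact: measure0. Qed.

Let lebesgue_consr_ge0 A : 0 <= lebesgue_consr A.
Proof. exact: measure_ge0. Qed.

Let lebesgue_consr_semi_sigma_additive : semi_sigma_additive lebesgue_consr.
Proof. exact: measure_semi_sigma_additive. Qed.

HB.instance Definition _ := isMeasure.Build _ _ _ lebesgue_consr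
  lebesgue_consr0 lebesgue_consr_ge0 lebesgue_consr_semi_sigma_additive.

End lebesgue_consr.

(* R^0 is a point, and R^{n+1} = R x R^n carries the product measure. *)
Fixpoint lebesgue_rV (n : nat) : {measure set 'rV[R]_n -> \bar R} :=
  match n with
  | 0 => \d_(0%R : 'rV[R]_0)
  | n'.+1 => lebesgue_consr (lebesgue_rV n')
  end.

Lemma measurable_box_rV (n : nat) (A : 'I_n -> set (measurableTypeR R)) :
  (forall i, measurable (A i)) ->
  measurable [set v : 'rV[R]_n | forall i, A i (v ord0 i)].
Proof.
move=> mA; rewrite (_ : mkset _ = \big[setI/setT]_(i < n)
   ((fun v : 'rV[R]_n => v ord0 i) @^-1` (A i))).
  apply: bigsetI_measurable => i _; rewrite -[X in measurable X]setTI.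
  exact: (measurable_coord_rV i measurableT (mA i)).
apply/seteqP; split=> v; rewrite -bigcap_seq /=.
  by move=> Av i _; exact: Av.
by move=> Av i; apply: Av; rewrite /= mem_index_enum.
Qed.

Lemma lebesgue_rV_box (n : nat) (A : 'I_n -> set (measurableTypeR R)) :
  (forall i, measurable (A i)) ->
  lebesgue_rV n [set v | forall i, A i (v ord0 i)] =
  \prod_(i < n) lebesgue_measure (A i).
Proof.
elim: n A => [|n IH] A mA.
  by rewrite big_ord0 /= diracE mem_set// => -[].
rewrite big_ord_recl /= -IH; last by move=> i; exact: mA.
rewrite -product_measure2E//; last first.
  exact: (measurable_box_rV (fun i => mA (lift ord0 i))).
rewrite /lebesgue_consr /pushforward; congr (_ _).
apply/seteqP; split=> -[x v] /=.
  move=> Av; split; first by have := Av ord0; rewrite mxE unlift_none.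
  by move=> i; have := Av (lift ord0 i); rewrite mxE liftK.
by move=> [Ax Av] i; rewrite mxE; case: unliftP => [j|] ->.
Qed.

End lebesgue_rV.

Section density.
Context (R : realType) (n : nat).
Implicit Types (c x : 'rV[R]_n) (t : R) (L : set 'rV[R]_n).

(* The norm [`|x|] of the library on ['rV[R]_n] is the max norm. *)
Definition enorm x : R := Num.sqrt (\sum_(i < n) x ord0 i ^+ 2).

Definition cball c t : set 'rV[R]_n := [set x | enorm (x - c) <= t].

Definition uniformly_discrete L :=
  forall x y, L x -> L y -> x != y -> 1 <= enorm (x - y).

Definition translate L x : set 'rV[R]_n := [set y - x | y in L].

Definition packing L : set 'rV[R]_n := \bigcup_(l in L) cball l 2^-1.

Definition density L : \bar R :=
  limf_esup (fun T : R =>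
    (lebesgue_rV R n (packing L `&` cball 0 T) /
     lebesgue_rV R n (cball 0 T))%E) +oo.

Definition norm1 (g : 'rV[R]_n -> R) : \bar R :=
  limf_esup (fun t : R =>
    let tB := [set t *: x | x in cball 0 2^-1] in
    ((lebesgue_rV R n tB)^-1 * \int[lebesgue_rV R n]_(x in tB) `|g x|%:E)%E) +oo.

End density.

Section metric_D.
Context (R : realType) (n : nat) (f : 'rV[R]_n -> R).
Implicit Types (alpha x c : 'rV[R]_n) (L : set 'rV[R]_n).

Record admissible : Prop := Admissible {
  admissible_continuous : continuous f ;
  admissible_range : forall t, 0 <= f t <= 1 ;
  admissible_support : forall t, ~ cball 0 1 t -> f t = 0 ;
  admissible0 : f 0 = 1 ;
  (* row vectors: [t *m rho] is the image of t under the transpose of rho *)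
  admissible_orthogonal : forall (rho : 'M[R]_n) t,
    rho *m rho^T = 1%:M -> f (t *m rho) = f t ;
  admissible_bound : forall t l, cball 0 1 t ->
    f t <= (2^-1 + enorm (l - 2^-1 *: t)) / (2^-1 + enorm l) }.

Definition center_radius_sets : set (set 'rV[R]_n * set R) :=
  [set PE | [/\ countable PE.1, countable PE.2 &
                PE.2 `<=` [set e | 0 < e < 2^-1]]].

(* The open ball of center [c] and radius [e] is encoded by the pair [(c, e)]. *)
Definition ball_collections (PE : set 'rV[R]_n * set R) :
    set {fset 'rV[R]_n * R} :=
  [set Bm | (forall b, b \in Bm -> PE.1 b.1 /\ PE.2 b.2) /\
            (forall b b', b \in Bm -> b' \in Bm -> b != b' ->
               1 <= enorm (b.1 - b'.1))].

(* For [L] uniformly discrete and [b.2 < 1/2], at most one term of the inner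
   sum is nonzero, so that it is a genuine sum (and not the default value 0 of
   [\sum_(x \in L)] for families of infinite support). *)
Definition phi (Bm : {fset 'rV[R]_n * R}) L : R :=
  \sum_(b <- Bm) \sum_(x \in L) b.2 * f (b.2^-1 *: (x - b.1)).

(* Suprema are taken in [\bar R], where they always exist; for admissible [f]
   and uniformly discrete sets they are at most 1. *)
Definition dist_alpha alpha (PE : set 'rV[R]_n * set R) L L' : \bar R :=
  ereal_sup [set (`|phi Bm L - phi Bm L'| /
      (2^-1 + enorm alpha + \sum_(b <- Bm) enorm (alpha - b.1)))%:E
    | Bm in ball_collections PE].

Definition dist_d L L' : \bar R :=
  ereal_sup [set dist_alpha aPE.1 aPE.2 L L' |
              aPE in [set: 'rV[R]_n] `*` center_radius_sets].

Definition dist_D L L' : \bar R :=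
  ereal_sup [set dist_d (translate L x) (translate L' x) | x in [set: 'rV[R]_n]].

Lemma dist_DE_le L L' (e : \bar R) :
  (forall x alpha PE Bm, center_radius_sets PE -> ball_collections PE Bm ->
    ((`|phi Bm (translate L x) - phi Bm (translate L' x)| /
      (2^-1 + enorm alpha + \sum_(b <- Bm) enorm (alpha - b.1)))%:E <= e)%E) ->
  (dist_D L L' <= e)%E.
Proof.
move=> H; apply: ge_ereal_sup => _ [x _ <-].
apply: ge_ereal_sup => _ [[alpha PE] [_ hPE] <-].
by apply: ge_ereal_sup => _ [Bm hBm <-]; exact: (H _ _ PE).
Qed.

Lemma le_dist_D L L' x alpha PE Bm :
  center_radius_sets PE -> ball_collections PE Bm ->
  ((`|phi Bm (translate L x) - phi Bm (translate L' x)| /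
      (2^-1 + enorm alpha + \sum_(b <- Bm) enorm (alpha - b.1)))%:E
   <= dist_D L L')%E.
Proof.
move=> hPE hBm.
apply: (@le_trans _ _ (dist_d (translate L x) (translate L' x))); last first.
  by apply: ereal_sup_ubound; exists x.
apply: (@le_trans _ _ (dist_alpha alpha PE (translate L x) (translate L' x))).
  by apply: ereal_sup_ubound; exists Bm.
by apply: ereal_sup_ubound; exists (alpha, PE).
Qed.

Lemma dist_Dxx L : (dist_D L L <= 0)%E.
Proof. by apply: dist_DE_le => *; rewrite subrr normr0 mul0r. Qed.

Lemma dist_D_sym L L' : dist_D L L' = dist_D L' L.
Proof.
by apply/eqP; rewrite eq_le; apply/andP; split;
  apply: dist_DE_le => x alpha PE Bm hPE hBm; rewrite distrC;
  exact: (le_dist_D _ _ _ _ hPE).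
Qed.

Lemma dist_D_triangle (L1 L2 L3 : set 'rV[R]_n) (e1 e2 : R) :
  (dist_D L1 L2 < e1%:E)%E -> (dist_D L2 L3 < e2%:E)%E ->
  (dist_D L1 L3 < (e1 + e2)%:E)%E.
Proof.
have D_ge0 L L' : (0 <= dist_D L L')%E.
  apply: le_trans (@le_dist_D L L' 0 0 (set0, set0) fset0 _ _); last 2 first.
  - by split => //=; exact: countable0.
  - by split => b.
  by rewrite lee_fin divr_ge0// big_seq_fset0 addr0 addr_ge0 ?sqrtr_ge0.
move=> D1 D2.
have fin L L' e : (dist_D L L' < e%:E)%E -> dist_D L L' \is a fin_num.
  by move=> h; rewrite ge0_fin_numE//; exact: (lt_trans h (ltry _)).
rewrite EFinD; apply: (@le_lt_trans _ _ (dist_D L1 L2 + dist_D L2 L3)%E); last first.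
  by apply: lteD.
apply: dist_DE_le => x alpha PE Bm hPE hBm.
apply: le_trans (leeD (le_dist_D L1 L2 x alpha hPE hBm)
  (le_dist_D L2 L3 x alpha hPE hBm)).
rewrite -EFinD lee_fin -mulrDl ler_wpM2r//; last exact: ler_distD.
rewrite invr_ge0 !addr_ge0// ?sqrtr_ge0//.
by apply: sumr_ge0 => b _; exact: sqrtr_ge0.
Qed.

End metric_D.

Record UD (R : realType) (n : nat) := MkUD {
  UD_set :> set 'rV[R]_n ;
  UD_prop : uniformly_discrete UD_set }.

(* UD as a space whose topology is generated by the balls of D; the parameter
   [f], on which D depends, selects the topology. *)
Definition UD_space (R : realType) (n : nat) (f : 'rV[R]_n -> R) : Type := UD R n.

Section UD_topology.
Context (R : realType) (n : nat) (f : 'rV[R]_n -> R).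

HB.instance Definition _ := gen_eqMixin (UD_space f).
HB.instance Definition _ := gen_choiceMixin (UD_space f).

Definition UD_ball (L : UD_space f) (e : R) : set (UD_space f) :=
  [set L' : UD_space f | (dist_D f (UD_set L) (UD_set L') < e%:E)%E].

Let UD_ent : set_system (UD_space f * UD_space f) := entourage_ UD_ball.

Let UD_nbhs (L : UD_space f) : set_system (UD_space f) := nbhs_ UD_ent L.

HB.instance Definition _ := hasNbhs.Build (UD_space f) UD_nbhs.

Let UD_ball_center (L : UD_space f) (e : R) : 0 < e -> UD_ball L e L.
Proof. by move=> e0; apply: le_lt_trans (dist_Dxx f _) _; rewrite lte_fin. Qed.

Let UD_ball_sym (L L' : UD_space f) (e : R) : UD_ball L e L' -> UD_ball L' e L.
Proof. by rewrite /UD_ball /= dist_D_sym. Qed.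

Let UD_ball_triangle (L1 L2 L3 : UD_space f) (e1 e2 : R) :
  UD_ball L1 e1 L2 -> UD_ball L2 e2 L3 -> UD_ball L1 (e1 + e2) L3.
Proof. exact: dist_D_triangle. Qed.

HB.instance Definition _ := Nbhs_isPseudoMetric.Build R (UD_space f)
  erefl UD_ball_center UD_ball_sym UD_ball_triangle erefl.

End UD_topology.

Definition locally_constant (X : topologicalType) (Y : Type) (g : X -> Y) : Prop :=
  forall x : X, \forall y \near x, g y = g x.

(* Main.v *)
(* If D(L, L') < 1/2, test the distance at each point l of L with a single ball
   of radius 1/4 centred at l: L' must have a point within 1/4 of l, which yields
   an injection of L into L' moving points by at most 1/4. Comparing volumes,
   the part of the packing of L inside B(0, T) has at most the volume of the part
   of the packing of L' inside B(0, T + 2); since vol B(0, T + 2) / vol B(0, T)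
   tends to 1, the density of L is at most that of L'. By symmetry of D the two
   densities agree. *)
Require Import Defs.
From mathcomp Require Import all_boot all_order all_algebra.
From mathcomp Require Import finmap.
From mathcomp Require Import all_classical all_reals all_analysis.
From mathcomp Require Import measurable_realfun.
Import Order.TTheory GRing.Theory Num.Theory.
Import numFieldNormedType.Exports.
Local Open Scope classical_set_scope.
Local Open Scope ring_scope.

Set Implicit Arguments.
Unset Strict Implicit.
Unset Printing Implicit Defensive.

(** * Lebesgue measure under the maps v -> r v + c *)

Section Affine.
Variable R : realType.
Local Notation vol := (lebesgue_rV R _).

(** By uniqueness of Lebesgue measure it suffices to compare the two sides on the intervals ]a, b],
    whose preimages are ](a - c) / r, (b - c) / r]. *)
Lemma lebesgue_measure_affine (r c : R) (A : set (measurableTypeR R)) : 0 < r ->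
  measurable A ->
  lebesgue_measure A = (r%:E * lebesgue_measure ((fun x => (r * x + c)%R) @^-1` A))%E.
Proof.
move=> r0 mA.
pose F := (fun x => r * x + c) : measurableTypeR R -> measurableTypeR R.
have mF : measurable_fun setT F.
  by apply: measurable_funD => //; exact: measurable_funM.
apply: (@lebesgue_measure_unique R
  (mscale (NngNum (ltW r0)) (pushforward lebesgue_measure F)) _ A mA) => //.
move=> _ [[a b] _ <-].
rewrite /= /mscale /pushforward /=.
have FE : F @^-1` `]a, b]%classic = `](a - c) / r, (b - c) / r]%classic.
  apply/seteqP; split=> x /=;
    by rewrite !in_itv/= ltr_pdivrMr// ler_pdivlMr// ltrBlDr lerBrDr (mulrC x).
rewrite [X in (_ * lebesgue_measure X)%E]FE !lebesgue_measure_itv/=.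
rewrite !lte_fin ltr_pM2r ?invr_gt0// ltrD2r.
case: ifP => _; last by rewrite mule0.
rewrite -!EFinB -EFinM; congr EFin.
by rewrite -mulrBl mulrC divfK ?gt_eqF// opprB addrA subrK.
Qed.

Lemma measurable_fun_affine_rV n (r : R) (c : 'rV[R]_n) :
  measurable_fun setT (fun v : 'rV[R]_n => r *: v + c).
Proof.
apply: measurable_fun_rVP => i.
apply: (eq_measurable_fun (fun v : 'rV[R]_n =>
    r * v ord0 i + c ord0 i : measurableTypeR R)).
  by move=> v _; rewrite !mxE.
apply: measurable_funD => //; apply: measurable_funM => //.
exact: measurable_coord_rV.
Qed.

(** Induction on [n] along R^{n+1} = R x R^n: the measure of [A] is the integral over R^n of the
    lengths of its sections. Changing variables in R^n contributes r^n, and the one-dimensional case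
    on each section contributes the last factor r. *)
Lemma lebesgue_rV_affine n (r : R) (c : 'rV[R]_n) A : 0 < r -> measurable A ->
  vol A = ((r ^+ n)%:E * vol ((fun v => (r *: v + c)%R) @^-1` A))%E.
Proof.
move=> r0; elim: n => [|n IH] in c A *.
  move=> mA; rewrite expr0 mul1e; congr (_ _).
  by apply/seteqP; split=> x /=; rewrite [_ + c]thinmx0 [x]thinmx0.
move=> mA; rewrite /= /lebesgue_consr /pushforward /product_measure2.
pose c' : 'rV[R]_n := \row_i c ord0 (lift ord0 i).
pose B := @cons_rV R n @^-1` A.
have mB : measurable B by rewrite -[B]setTI; exact: measurable_cons_rV.
pose h y := lebesgue_measure (ysection B y).
have mh : measurable_fun setT h by exact: measurable_fun_ysection.
have mg := @measurable_fun_affine_rV n r c'.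
set g := (fun v => _) in mg.
pose k := NngNum (exprn_ge0 n (ltW r0)).
rewrite -/B.
(* The induction hypothesis is read as an identity of measures: Lebesgue measure on R^n is r^n times
   its image under [g]. *)
rewrite (@eq_measure_integral _ _ _ _
  (mscale k (pushforward (lebesgue_rV R n) g)) (lebesgue_rV R n)) => //; last first.
  by move=> X mX _; exact: IH.
rewrite ge0_integral_mscale//.
rewrite exprS mulrC EFinM -muleA; congr (_ * _)%E.
rewrite ge0_integral_pushforward//.
rewrite preimage_setT -ge0_integralZl//; last 2 first.
- apply: measurable_fun_ysection; rewrite -[X in measurable X]setTI.
  apply: measurable_cons_rV => //; rewrite -[X in measurable X]setTI.
  exact: measurable_fun_affine_rV.
- by rewrite lee_fin ltW.
apply: eq_integral => y _ /=.
rewrite (@lebesgue_measure_affine r (c ord0 ord0)) //; last exact: measurable_ysection.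
congr (_ * lebesgue_measure _)%E.
suff E x : cons_rV (r * x + c ord0 ord0, g y) = r *: cons_rV (x, y) + c.
  by apply/seteqP; split=> x; rewrite /ysection /= !inE /B /= E.
apply/rowP => i; rewrite !mxE.
by case: unliftP => [k' ->|->]; rewrite ?mxE.
Qed.

End Affine.

(** * The Euclidean norm and the volumes of its balls *)

Section EuclideanNorm.
Variables (R : realType) (n : nat).
Implicit Types (x y c : 'rV[R]_n) (r t : R).

Lemma enorm_ge0 x : 0 <= enorm x.
Proof. exact: sqrtr_ge0. Qed.

Lemma sqr_enorm x : enorm x ^+ 2 = \sum_(i < n) x ord0 i ^+ 2.
Proof. by rewrite sqr_sqrtr// sumr_ge0// => i _; exact: sqr_ge0. Qed.

Lemma enormZ r x : enorm (r *: x) = `|r| * enorm x.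
Proof.
rewrite /enorm -sqrtr_sqr -sqrtrM ?sqr_ge0// mulr_sumr.
by congr Num.sqrt; apply: eq_bigr => i _; rewrite mxE exprMn.
Qed.

Lemma enormN x : enorm (- x) = enorm x.
Proof. by rewrite -scaleN1r enormZ normrN1 mul1r. Qed.

Lemma enormB x y : enorm (x - y) = enorm (y - x).
Proof. by rewrite -opprB enormN. Qed.

Lemma enorm0 : enorm (0 : 'rV[R]_n) = 0.
Proof. by rewrite -(scale0r 0) enormZ normr0 mul0r. Qed.

Lemma enorm0_eq0 x : enorm x = 0 -> x = 0.
Proof.
move=> x0; apply/rowP => i; rewrite mxE; apply/eqP; rewrite -sqrf_eq0.
have /eqP := sqr_enorm x; rewrite x0 expr0n/= eq_sym psumr_eq0.
  by move=> /allP/(_ i (mem_index_enum i)).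
by move=> j _; exact: sqr_ge0.
Qed.

(** With A, B the norms and S the scalar product, the sum of the squares (B x_i - A y_i)^2 equals
    2AB(AB - S). It is nonnegative, and AB > 0 can be cancelled once zero norms are set aside. *)
Lemma cauchy_schwarz_enorm x y :
  \sum_(i < n) x ord0 i * y ord0 i <= enorm x * enorm y.
Proof.
set A := enorm x; set B := enorm y; set S := \sum_i _.
have [A0|A0] := eqVneq A 0.
  rewrite A0 mul0r /S (enorm0_eq0 A0) big1// => i _.
  by rewrite mxE mul0r.
have [B0|B0] := eqVneq B 0.
  rewrite B0 mulr0 /S (enorm0_eq0 B0) big1// => i _.
  by rewrite mxE mulr0.
have AB : 0 < A * B by rewrite mulr_gt0// lt0r ?A0 ?B0 enorm_ge0.
have : 0 <= \sum_(i < n) (B * x ord0 i - A * y ord0 i) ^+ 2.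
  by apply: sumr_ge0 => i _; exact: sqr_ge0.
have -> : \sum_(i < n) (B * x ord0 i - A * y ord0 i) ^+ 2 =
    (A * B) * (A * B - S) *+ 2.
  under eq_bigr do rewrite sqrrB !exprMn.
  rewrite big_split sumrB/= -!mulr_sumr -!sqr_enorm -/A -/B.
  under eq_bigr do rewrite mulrACA.
  rewrite sumrMnl -mulr_sumr -/S [B * A]mulrC mulrBr mulrnBl [B ^+ 2 * _]mulrC.
  by rewrite -exprMn -expr2 addrAC -mulr2n.
by rewrite pmulrn_lge0// pmulr_rge0// subr_ge0.
Qed.

Lemma enormD x y : enorm (x + y) <= enorm x + enorm y.
Proof.
rewrite -ler_sqr ?nnegrE ?addr_ge0 ?enorm_ge0// sqrrD !sqr_enorm.
under eq_bigr do rewrite mxE sqrrD.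
rewrite !big_split/= lerD2r lerD2l.
by rewrite mulr2n lerD ?cauchy_schwarz_enorm.
Qed.

Lemma enorm_dist x y c : enorm (x - y) <= enorm (x - c) + enorm (c - y).
Proof. by apply: le_trans (enormD _ _); rewrite addrA subrK. Qed.

Definition oball c t : set 'rV[R]_n := [set x | enorm (x - c) < t].

Lemma measurable_enormB c : measurable_fun setT (fun x => enorm (x - c)).
Proof.
apply: (@measurableT_comp _ _ _ _ _ _ (@Num.sqrt R)).
  by apply: continuous_measurable_fun; exact: sqrt_continuous.
apply: measurable_sum => i; apply: measurable_funX.
rewrite (_ : (fun x => _) = (fun x : 'rV[R]_n => x ord0 i - c ord0 i)); last first.
  by apply/funext => x; rewrite !mxE.
by apply: measurable_funB => //; exact: measurable_coord_rV.
Qed.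

Lemma measurable_cball c t : measurable (cball c t).
Proof.
rewrite -[cball c t]setTI (_ : cball c t =
    (fun x => enorm (x - c)) @^-1` `]-oo, t]%classic).
  by apply: measurable_enormB => //; exact: measurable_itv.
by apply/seteqP; split=> x /=; rewrite in_itv.
Qed.

Lemma measurable_oball c t : measurable (oball c t).
Proof.
rewrite -[oball c t]setTI (_ : oball c t =
    (fun x => enorm (x - c)) @^-1` `]-oo, t[%classic).
  by apply: measurable_enormB => //; exact: measurable_itv.
by apply/seteqP; split=> x /=; rewrite in_itv.
Qed.

Local Notation vol := (lebesgue_rV R n).

Lemma lebesgue_rV_cball c r : 0 < r ->
  vol (cball c r) = ((r ^+ n)%:E * vol (cball 0 1))%E.
Proof.
move=> r0; rewrite (@lebesgue_rV_affine R n r c)//; last exact: measurable_cball.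
congr (_ * vol _)%E; apply/seteqP; split=> x;
  by rewrite /cball /= addrK subr0 enormZ gtr0_norm// -ler_pdivlMl// mulVf ?gt_eqF.
Qed.

Lemma lebesgue_rV_oball c r : 0 < r ->
  vol (oball c r) = ((r ^+ n)%:E * vol (oball 0 1))%E.
Proof.
move=> r0; rewrite (@lebesgue_rV_affine R n r c)//; last exact: measurable_oball.
congr (_ * vol _)%E; apply/seteqP; split=> x;
  by rewrite /oball /= addrK subr0 enormZ gtr0_norm// -ltr_pdivlMl// mulVf ?gt_eqF.
Qed.

Lemma lebesgue_rV_cball1_lty : (vol (cball 0 1) < +oo)%E.
Proof.
(* The unit ball lies in the cube [-1, 1]^n. *)
pose B := [set v : 'rV[R]_n | forall i, `[-1, 1]%classic (v ord0 i)].
have mB : measurable B.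
  by apply: (@measurable_box_rV R n (fun=> `[-1,1]%classic)) => i;
    exact: measurable_itv.
apply: (@le_lt_trans _ _ (vol B)).
  apply: le_measure; rewrite ?inE//; first exact: measurable_cball.
  move=> x; rewrite /cball /B /= subr0 => x1 i.
  rewrite in_itv /= -ler_norml -sqrtr_sqr; apply: le_trans x1.
  rewrite ler_wsqrtr// (bigD1 i)//= lerDl sumr_ge0// => j _; exact: sqr_ge0.
rewrite (@lebesgue_rV_box R n (fun=> `[-1,1]%classic)); last first.
  by move=> i; exact: measurable_itv.
rewrite (eq_bigr (fun=> (1 - -1 : R)%:E)); last first.
  move=> i _; rewrite lebesgue_measure_itv/= lte_fin.
  by rewrite (lt_trans (ltrN10 R) ltr01) -EFinB.
rewrite prodEFin; exact: ltry.
Qed.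

Lemma lebesgue_rV_cball1_gt0 : (0 < vol (cball 0 1))%E.
Proof.
(* The cube [0, a]^n lies in the unit ball because the squares sum to at most n a^2 <= n a <= 1.
   Taking n + 1 in place of n keeps [a] positive when n = 0. *)
pose a : R := n.+1%:R^-1.
have a0 : 0 < a by rewrite invr_gt0.
pose B := [set v : 'rV[R]_n | forall i, `[0, a]%classic (v ord0 i)].
have mB : measurable B.
  by apply: (@measurable_box_rV R n (fun=> `[0,a]%classic)) => i; exact: measurable_itv.
apply: (@lt_le_trans _ _ (vol B)); last first.
  apply: le_measure; rewrite ?inE//; first exact: measurable_cball.
  move=> x; rewrite /cball /B /= subr0 => xa.
  rewrite -(sqrtr1 R) ler_wsqrtr//.
  apply: (@le_trans _ _ (\sum_(i < n) a)).
    apply: ler_sum => i _; have := xa i; rewrite in_itv/= => /andP[x0 xa1].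
    rewrite expr2 (le_trans (ler_pM x0 x0 xa1 xa1))// ger_pMl// invf_le1//.
    by rewrite ler1n.
  by rewrite sumr_const card_ord -mulr_natl ler_pdivrMr// mul1r ler_nat.
rewrite (@lebesgue_rV_box R n (fun=> `[0,a]%classic)); last first.
  by move=> i; exact: measurable_itv.
rewrite (eq_bigr (fun=> a%:E)); last first.
  by move=> i _; rewrite lebesgue_measure_itv/= lte_fin a0 -EFinB subr0.
by rewrite prodEFin lte_fin prodr_gt0.
Qed.

(** For 0 < s < 1 the closed ball of radius s, of volume s^n times that of the closed unit ball,
    lies in the open unit ball. Let s tend to 1 from below. *)
Lemma lebesgue_rV_oball1 : vol (oball 0 1) = vol (cball 0 1).
Proof.
have mo := measurable_oball 0 1; have mc := measurable_cball 0 1.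
have oc : (vol (oball 0 1) <= vol (cball 0 1))%E.
  by apply: le_measure; rewrite ?inE// => x; exact: ltW.
apply/eqP; rewrite eq_le oc/=.
have cfin : vol (cball 0 1) \is a fin_num.
  by rewrite ge0_fin_numE// lebesgue_rV_cball1_lty.
have ofin : vol (oball 0 1) \is a fin_num.
  by rewrite ge0_fin_numE// (le_lt_trans oc)// lebesgue_rV_cball1_lty.
rewrite -(fineK cfin) -(fineK ofin) lee_fin.
apply: (@cvgr_to_le R (1^'-) _ R (fun s : R => s ^+ n * fine (vol (cball 0 1)))).
  have : (fun s : R => s ^+ n * fine (vol (cball 0 1))) s @[s --> 1^'-]
      --> (1 : R) ^+ n * fine (vol (cball 0 1)).
    by apply: cvgMl; apply: cvg_at_left_filter; exact: exprn_continuous.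
  by rewrite expr1n mul1r.
near=> s.
have s0 : 0 < s by near: s; exact: nbhs_left_gt.
rewrite -lee_fin EFinM !fineK// -(@lebesgue_rV_cball 0)//.
apply: le_measure; rewrite ?inE//; first exact: measurable_cball.
move=> x; rewrite /cball /oball /=; move/le_lt_trans; apply.
by near: s; exact: nbhs_left_lt.
Unshelve. all: by end_near. Qed.
End EuclideanNorm.

(** * Packings by balls of radius 1/2 *)

Section Packing.
Variables (R : realType) (n : nat).
Implicit Types (L : set 'rV[R]_n) (T : R).
Local Notation vol := (lebesgue_rV R n).
Local Notation half_ball_volume := (vol (cball 0 2^-1)).

Let half_gt0 : 0 < 2^-1 :> R. Proof. by rewrite invr_gt0. Qed.

Let half_add : 2^-1 + 2^-1 = 1 :> R.
Proof. by rewrite -mulr2n -[LHS]mulr_natl mulfV. Qed.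

Lemma half_cballE c : vol (cball c 2^-1) = half_ball_volume.
Proof. by rewrite [LHS]lebesgue_rV_cball// [RHS]lebesgue_rV_cball. Qed.

Lemma half_oballE c : vol (oball c 2^-1) = half_ball_volume.
Proof.
by rewrite lebesgue_rV_oball// lebesgue_rV_oball1 [RHS]lebesgue_rV_cball.
Qed.

Lemma cball_volume_fin_num c T : 0 < T -> vol (cball c T) \is a fin_num.
Proof.
move=> T0; rewrite lebesgue_rV_cball// fin_numM// ge0_fin_numE//.
exact: lebesgue_rV_cball1_lty.
Qed.

Lemma cball_volume_gt0 c T : 0 < T -> (0 < vol (cball c T))%E.
Proof.
move=> T0; rewrite lebesgue_rV_cball// mule_gt0 ?lebesgue_rV_cball1_gt0//.
by rewrite lte_fin exprn_gt0.
Qed.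

(** A common point of two open balls of radius 1/2 would put their centers at distance less than
    1. *)
Lemma trivIset_oball (I : Type) (D : set I) L (g : I -> 'rV[R]_n) :
  uniformly_discrete L -> (forall i, D i -> L (g i)) ->
  (forall i j, D i -> D j -> g i = g j -> i = j) ->
  trivIset D (fun i => oball (g i) 2^-1).
Proof.
move=> udL DL inj i j Di Dj [x [xi xj]]; apply: inj => //.
apply: contrapT => /eqP ij; have := udL _ _ (DL _ Di) (DL _ Dj) ij.
apply/negP; rewrite -ltNge; apply: le_lt_trans (enorm_dist _ _ x) _.
by rewrite -half_add ltrD// enormB.
Qed.

Lemma cball_sub c r T : enorm c <= T -> cball c r `<=` cball (0 : 'rV[R]_n) (T + r).
Proof.
move=> cT x; rewrite /cball /= => xc; rewrite subr0 -[x](subrK c) addrC.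
by apply: le_trans (enormD _ _) _; rewrite lerD.
Qed.

(* The closed balls of a packing may touch, so the proof goes through the open
   ones, which are disjoint and have the same volume. *)
Lemma sum_half_ball_le (I : choiceType) (D : set I) L (g : I -> 'rV[R]_n)
    (A : set 'rV[R]_n) T :
  uniformly_discrete L -> finite_set D -> measurable A ->
  packing L `&` cball 0 (T + 2^-1) `<=` A ->
  (forall i, D i -> L (g i) /\ enorm (g i) <= T) ->
  (forall i j, D i -> D j -> g i = g j -> i = j) ->
  (\sum_(i \in D) half_ball_volume <= vol A)%E.
Proof.
move=> udL finD mA subA DL inj.
rewrite (eq_fsbigr (fun i => vol (oball (g i) 2^-1))); last first.
  by move=> i _; rewrite half_oballE.
rewrite -measure_fin_bigcup//; last 2 first.
- by apply: trivIset_oball udL _ inj => i /DL[].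
- by move=> i _; exact: measurable_oball.
apply: le_measure; rewrite ?inE//.
  by apply: fin_bigcup_measurable => // i _; exact: measurable_oball.
move=> x [i Di xi]; have [Lgi giT] := DL _ Di.
have xi' : cball (g i) 2^-1 x by exact: ltW.
apply: subA; split; first by exists (g i).
exact: cball_sub giT _ xi'.
Qed.

(** Infinitely many centers would give more disjoint half-balls than the volume of a slightly larger
    ball can hold. *)
Lemma uniformly_discrete_finite L T : uniformly_discrete L ->
  finite_set (L `&` cball 0 T).
Proof.
move=> udL; apply: contrapT => inf.
(* The absolute value keeps the radius positive even for negative [T]. *)
have T0 : 0 < `|T| + 2^-1 by rewrite ltr_wpDl.
have vfin := cball_volume_fin_num 0 T0.
have hfin := cball_volume_fin_num 0 half_gt0.
have hgt0 : 0 < fine half_ball_volume.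
  by rewrite -lte_fin fineK// cball_volume_gt0.
(* [B] has more elements than the ratio of the volume of the large ball to that of a half-ball. *)
have [B BL kB] := infinite_set_fset
  (Num.bound (fine (vol (cball 0 (`|T| + 2^-1))) / fine half_ball_volume)) inf.
have : (\sum_(i \in [set` B]) half_ball_volume <= vol (cball 0 (`|T| + 2^-1)))%E.
  apply: (@sum_half_ball_le _ _ L id _ `|T|) => //.
  - exact: measurable_cball.
  - move=> i /BL[Li iT]; split => //; move: iT; rewrite /cball /= subr0.
    by move=> /le_trans; apply; exact: ler_norm.
rewrite -(fineK hfin) -(fineK vfin) -fsbig_seq ?fset_uniq//= sumEFin lee_fin.
rewrite big_const_seq count_predT iter_addr_0 -[leLHS]mulr_natl -ler_pdivlMr//.
apply/negP; rewrite -ltNge; apply: lt_le_trans (_ : (#|` B|%:R <= _)); last by [].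
apply: lt_le_trans (archi_boundP _) _; last by rewrite ler_nat.
by rewrite divr_ge0// fine_ge0.
Qed.

(** Cutting [L] by the balls of integer radius k presents the packing as a countable union of finite
    unions of closed balls. *)
Lemma measurable_packing L : uniformly_discrete L -> measurable (packing L).
Proof.
move=> udL.
rewrite (_ : packing L = \bigcup_k \bigcup_(l in L `&` cball 0 k%:R) cball l 2^-1).
  apply: bigcup_measurable => k _; apply: fin_bigcup_measurable.
    exact: uniformly_discrete_finite.
  by move=> l _; exact: measurable_cball.
apply/seteqP; split=> [x [l Ll xl]|x [k _ [l [Ll _] xl]]]; last by exists l.
exists (Num.bound (enorm l)) => //; exists l => //; split => //.
by rewrite /cball /= subr0 ltW// archi_boundP// enorm_ge0.
Qed.

(** Both sides are compared with N times the volume of a half-ball, N being the number of points of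
    [L] in B(0, T + 1/2): the half-balls at these points cover the left-hand set, and the open
    half-balls at their images are disjoint inside the right-hand one. *)
Lemma packing_volume_le L L' (g : 'rV[R]_n -> 'rV[R]_n) T :
  uniformly_discrete L -> uniformly_discrete L' ->
  (forall l, L l -> L' (g l) /\ enorm (g l - l) <= 2^-1) ->
  (forall l m, L l -> L m -> g l = g m -> l = m) ->
  (vol (packing L `&` cball 0 T) <= vol (packing L' `&` cball 0 (T + 2)))%E.
Proof.
move=> udL udL' gL' inj.
pose D := L `&` cball 0 (T + 2^-1).
have finD : finite_set D by exact: uniformly_discrete_finite.
apply: (@le_trans _ _ (\sum_(l \in D) half_ball_volume)%E).
  rewrite (eq_fsbigr (fun l => vol (cball l 2^-1))); last first.
    by move=> l _; rewrite half_cballE.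
  apply: content_sub_fsum => //.
  - by move=> l _; exact: measurable_cball.
  - by apply: measurableI; [exact: measurable_packing|exact: measurable_cball].
  move=> x [[l Ll xl] xT]; exists l => //; split => //.
  have lx : cball x 2^-1 l by rewrite /cball /= enormB.
  by apply: cball_sub lx; move: xT; rewrite /cball /= subr0.
(* The images lie in B(0, T + 1), hence their half-balls in B(0, T + 3/2), which is contained in
   B(0, T + 2). *)
apply: (@sum_half_ball_le _ _ L' g _ (T + 2^-1 + 2^-1)) => //.
- by apply: measurableI; [exact: measurable_packing|exact: measurable_cball].
- apply: setIS => x; rewrite /cball /= => /le_trans; apply.
  by rewrite -!addrA lerD2l half_add [leRHS](natrD _ 1 1) lerD2r invf_le1 ?ler1n.
- move=> l [Ll lT]; have [L'gl gl] := gL' _ Ll; split => //.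
  have lT' : enorm l <= T + 2^-1 by move: lT; rewrite /cball /= subr0.
  by have := cball_sub lT' (gl : cball l 2^-1 (g l)); rewrite /cball /= subr0.
- by move=> l m [Ll _] [Lm _]; exact: inj.
Qed.
End Packing.

(** * Comparison of upper densities *)

Section Density.
Variables (R : realType) (n : nat).
Implicit Types (L : set 'rV[R]_n) (T : R).
Local Notation vol := (lebesgue_rV R n).

(** A neighbourhood V of infinity pulls back under [h] to another one, on which [F] is at most the
    supremum of [G] over V plus e. This covers both the shift T + 2 of radii and the rescalings
    between the two forms of the density. *)
Lemma limf_esup_le_comp (F G : R -> \bar R) (h : R -> R) :
  h x @[x --> +oo] --> +oo ->
  (forall e : R, 0 < e -> \forall x \near +oo, (F x <= G (h x) + e%:E)%E) ->
  (limf_esup F +oo%R <= limf_esup G +oo%R)%E.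
Proof.
move=> hoo FG; apply/lee_addgt0Pr => e e0; rewrite -leeBlDr//.
apply: le_ereal_inf_tmp => _ [V Voo <-]; rewrite leeBlDr//.
pose W := [set x | (F x <= G (h x) + e%:E)%E] `&` h @^-1` V.
have Woo : (+oo%R : set_system R) W by apply: filterI; [exact: FG|exact: hoo].
apply: (@le_trans _ _ (ereal_sup (F @` W))).
  by apply: ereal_inf_lbound; exists W.
apply: ge_ereal_sup => _ [x [Fx Vx] <-]; apply: (le_trans Fx).
by rewrite leeD2r//; apply: ereal_sup_ubound; exists (h x).
Qed.

(** The quantity is the ratio of the volumes of B(0, T + 2) and B(0, T); rewritten as (1 + 2 / T)^n,
    it tends to 1. *)
Lemma ball_ratio_near (e : R) : 0 < e ->
  \forall T \near +oo, ((T + 2) / T) ^+ n <= 1 + e.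
Proof.
move=> e0.
have lim1 : (1 + 2 * T^-1 : R) @[T --> +oo] --> (1 + 2 * 0 : R).
  apply: cvgD; first exact: cvg_cst.
  apply: cvgM; first exact: cvg_cst.
  by apply/(@gtr0_cvgV0 _ _ _ _ id) => //; exact: nbhs_pinfty_gt.
have : ((1 + 2 * T^-1) ^+ n : R) @[T --> +oo] --> ((1 + 2 * 0) ^+ n : R).
  exact: (cvg_comp _ _ lim1 (@exprn_continuous R n _)).
rewrite mulr0 addr0 expr1n => /cvgr_le /(_ (1 + e)).
rewrite ltrDl => /(_ e0) H.
near=> T.
have T0 : 0 < T by near: T; exact: nbhs_pinfty_gt.
rewrite mulrDl divff ?gt_eqF//.
by near: T.
Unshelve. all: by end_near. Qed.

Lemma packing_cball_le L T : measurable (packing L) ->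
  (vol (packing L `&` cball 0 T) <= vol (cball 0 T))%E.
Proof.
move=> mL; apply: le_measure; rewrite ?inE//; last exact: measurable_cball.
by apply: measurableI => //; exact: measurable_cball.
Qed.

Lemma packing_cball_fin_num L T : 0 < T -> measurable (packing L) ->
  vol (packing L `&` cball 0 T) \is a fin_num.
Proof.
move=> T0 mL; rewrite ge0_fin_numE// (le_lt_trans (packing_cball_le _ mL))//.
by rewrite -ge0_fin_numE// cball_volume_fin_num.
Qed.

Lemma fine_cball_volume_gt0 T : 0 < T -> 0 < fine (vol (cball 0 T)).
Proof.
by move=> T0; rewrite -lte_fin fineK ?cball_volume_gt0 ?cball_volume_fin_num.
Qed.

(** Moves the quotient from the extended reals to the field [R], where the estimates are made. *)
Lemma packing_ratioE L T : 0 < T -> measurable (packing L) ->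
  (vol (packing L `&` cball 0 T) / vol (cball 0 T))%E =
  (fine (vol (packing L `&` cball 0 T)) / fine (vol (cball 0 T)))%:E.
Proof.
move=> T0 mL; have v0 := fine_cball_volume_gt0 T0.
rewrite -[in LHS](fineK (cball_volume_fin_num 0 T0)).
by rewrite -[in LHS](fineK (packing_cball_fin_num T0 mL)) inver ifF ?gt_eqF.
Qed.

Lemma density_le L L' (g : 'rV[R]_n -> 'rV[R]_n) :
  uniformly_discrete L -> uniformly_discrete L' ->
  (forall l, L l -> L' (g l) /\ enorm (g l - l) <= 2^-1) ->
  (forall l m, L l -> L m -> g l = g m -> l = m) ->
  (density L <= density L')%E.
Proof.
move=> udL udL' gL' inj.
have mL := measurable_packing udL; have mL' := measurable_packing udL'.
apply: (@limf_esup_le_comp _ _ (fun T => T + 2)).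
  by apply: cvg_addrr.
move=> e e0; near=> T.
have T0 : 0 < T by near: T; exact: nbhs_pinfty_gt.
have T20 : 0 < T + 2 by rewrite addr_gt0.
rewrite !packing_ratioE// -EFinD lee_fin.
have := packing_volume_le T udL udL' gL' inj.
have := packing_cball_le (T + 2) mL'.
rewrite -(fineK (packing_cball_fin_num T0 mL)).
rewrite -(fineK (packing_cball_fin_num T20 mL')).
rewrite -(fineK (cball_volume_fin_num 0 T20)) !lee_fin /=.
have b0 := fine_cball_volume_gt0 T0; have b'0 := fine_cball_volume_gt0 T20.
have : fine (vol (cball 0 (T + 2))) / fine (vol (cball 0 T)) <= 1 + e.
  rewrite (lebesgue_rV_cball _ T0) (lebesgue_rV_cball _ T20).
  rewrite !fineM ?fin_num_fun//=; try by rewrite ge0_fin_numE ?lebesgue_rV_cball1_lty.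
  rewrite -mulf_div divff ?mulr1 -?expr_div_n; last first.
    by rewrite gt_eqF// fine_cball_volume_gt0.
  by near: T; exact: ball_ratio_near.
have : 0 <= fine (vol (packing L' `&` cball 0 (T + 2))) by exact: fine_ge0.
move: b0 b'0; move: (fine _) (fine _) (fine _) (fine _) => w v q p.
move=> p0 q0 v0 qp vq wv.
(* Here p and q are the volumes of B(0, T) and B(0, T + 2), and w and v those of the parts of the
   packings of [L] and [L'] inside them. Then w/p <= v/p = (v/q)(q/p) <= (v/q)(1 + e) <= v/q + e,
   the last step because v <= q. *)
apply: (@le_trans _ _ (v / p)); first by rewrite ler_pM2r ?invr_gt0.
have -> : v / p = v / q * (q / p) by rewrite mulrA divfK ?gt_eqF.
apply: (@le_trans _ _ (v / q * (1 + e))).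
  by rewrite ler_wpM2l// divr_ge0// ltW.
by rewrite mulrDr mulr1 lerD2l ler_piMl ?(ltW e0)// ler_pdivrMr// mul1r.
Unshelve. all: by end_near. Qed.


(** Since tB = B(0, t/2), the two upper limits differ only by the substitution t = 2T, and the
    comparison of upper limits applies both ways. *)
Lemma norm1_packing L : uniformly_discrete L -> density L = norm1 (\1_(packing L)).
Proof.
move=> udL; have mL := measurable_packing udL.
have E t : 0 < t -> (let tB := [set t *: x | x in cball (0:'rV[R]_n) 2^-1] in
    ((vol tB)^-1 * \int[vol]_(x in tB) `|\1_(packing L) x|%:E))%E =
   (vol (packing L `&` cball 0 (t / 2)) / vol (cball 0 (t / 2)))%E.
  move=> t0 /=.
  have -> : [set t *: x | x in cball (0:'rV[R]_n) 2^-1] = cball 0 (t / 2).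
    apply/seteqP; split=> [_ [x /= xB <-]|x]; rewrite /cball /= subr0.
      rewrite enormZ gtr0_norm// ler_pM2l//; move: xB; rewrite /cball /= subr0//.
    move=> xt; exists (t^-1 *: x); last by rewrite scalerA mulfV ?gt_eqF// scale1r.
    by rewrite /cball /= subr0 enormZ gtr0_norm ?invr_gt0// ler_pdivrMl.
  rewrite muleC; congr (_ / _)%E.
  rewrite -integral_indic//; last exact: measurable_cball.
  by apply: eq_integral => x _; rewrite ger0_norm.
apply/eqP; rewrite eq_le; apply/andP; split.
  apply: (@limf_esup_le_comp _ _ (fun T => 2 * T)).
    exact: gt0_cvgMry.
  move=> e e0; near=> T.
  have T0 : 0 < T by near: T; exact: nbhs_pinfty_gt.
  by rewrite E ?mulr_gt0// mulrAC divff// mul1r leeDl// lee_fin ltW.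
apply: (@limf_esup_le_comp _ _ (fun T => T / 2)).
  exact: gt0_cvgMly.
move=> e e0; near=> T.
have T0 : 0 < T by near: T; exact: nbhs_pinfty_gt.
by rewrite E// leeDl// lee_fin ltW.
Unshelve. all: by end_near. Qed.

End Density.

(** * Matching the points of two sets at distance [D] below 1/2 *)

Section Dist.
Variables (R : realType) (n : nat) (f : 'rV[R]_n -> R).
Hypothesis hf : admissible f.
Implicit Types L : set 'rV[R]_n.
(** The center can stay at the origin because [dist_D] takes a supremum over translations, which
    bring any point there. *)
Local Notation bump_at0 := [fset (0 : 'rV[R]_n, 4^-1 : R)]%fset.

Lemma admissible_far (x : 'rV[R]_n) : 4^-1 < enorm x ->
  4^-1 * f (4^-1^-1 *: (x - 0)) = 0.
Proof.
move=> xq; rewrite (admissible_support hf) ?mulr0// /cball /= !subr0 invrK.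
by apply/negP; rewrite -ltNge enormZ gtr0_norm// -ltr_pdivrMl// mulr1.
Qed.

(** Only [l] contributes, with value f(0)/4: the other points of [L] are at distance at least 1 from
    it, outside the test ball. *)
Lemma phi_center L l : uniformly_discrete L -> L l ->
  phi f bump_at0 (translate L l) = 4^-1.
Proof.
move=> udL Ll; rewrite /phi big_seq_fset1/=.
rewrite -(fsbig_widen [set 0]).
- by rewrite fsbig_set1 subr0 scaler0 (admissible0 hf) mulr1.
- by move=> _ ->; exists l => //; rewrite subrr.
- move=> _ [[y Ly <-] /= yl]; apply: admissible_far.
  apply: (@lt_le_trans _ _ 1); first by rewrite invf_lt1// ltr1n.
  by apply: udL => //; apply/eqP => yl'; apply: yl; rewrite yl' subrr.
Qed.

Lemma phi_far L l : (forall y, L y -> 4^-1 < enorm (y - l)) ->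
  phi f bump_at0 (translate L l) = 0.
Proof.
move=> far; rewrite /phi big_seq_fset1/= fsbig1// => _ [y Ly <-].
exact/admissible_far/far.
Qed.

(** Without such a point the test ball, translated to [l], takes the values 1/4 on [L] and 0 on
    [L']. With [alpha] = 0 the denominator is 1/2, so [D] would be at least (1/4)/(1/2) = 1/2; this
    is where the threshold comes from. *)
Lemma dist_D_lt_half_close L L' l : uniformly_discrete L -> L l ->
  (dist_D f L L' < (2^-1)%:E)%E -> exists2 l', L' l' & enorm (l' - l) <= 4^-1.
Proof.
move=> udL Ll DL; apply: contrapT => far.
have {}far y : L' y -> 4^-1 < enorm (y - l).
  by move=> L'y; rewrite ltNge; apply/negP => yl; apply: far; exists y.
have hPE : @center_radius_sets R n ([set 0], [set 4^-1]).
  split => //= _ -> /=.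
  by rewrite invr_gt0 ltr0n/= ltf_pV2 ?posrE// ltr_nat.
have hBm : ball_collections ([set 0], [set 4^-1]) bump_at0.
  split=> [b|b b']; rewrite !inE; first by move=> /eqP ->.
  by move=> /eqP -> /eqP ->; rewrite eqxx.
have := le_lt_trans (le_dist_D f L L' l 0 hPE hBm) DL.
rewrite phi_center// phi_far// big_seq_fset1/= !subr0 enorm0 !addr0 invrK.
rewrite ger0_norm// lte_fin.
have -> : 4 = 2 * 2 :> R by rewrite -natrM.
by rewrite invfM divfK ?pnatr_eq0// ltxx.
Qed.

Lemma dist_D_lt_half_density_le L L' :
  uniformly_discrete L -> uniformly_discrete L' ->
  (dist_D f L L' < (2^-1)%:E)%E -> (density L <= density L')%E.
Proof.
move=> udL udL' DL.
have /choice[g gP] : forall l, exists l', L l -> L' l' /\ enorm (l' - l) <= 4^-1.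
  (* Choice needs a total function; its value outside [L] is irrelevant and taken to be [l]. *)
  move=> l; have [Ll|nLl] := pselect (L l); last by exists l.
  by have [l' L'l' ll'] := dist_D_lt_half_close udL Ll DL; exists l'.
have lt42 : 4^-1 < 2^-1 :> R by rewrite ltf_pV2 ?posrE// ltr_nat.
apply: (density_le (g := g)) => // [l /gP[L'gl gl]|l m Ll Lm glm].
  by split => //; rewrite (le_trans gl)// ltW.
(* Two points of [L] with the same image are at distance at most 1/4 + 1/4 < 1, hence equal. *)
apply: contrapT => /eqP lm; have := udL _ _ Ll Lm lm; apply/negP; rewrite -ltNge.
have [_ gl] := gP _ Ll; have [_ gm] := gP _ Lm.
apply: le_lt_trans (enorm_dist _ _ (g l)) _; rewrite enormB [in X in _ + X]glm.
apply: le_lt_trans (lerD gl gm) _.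
apply: lt_le_trans (ltrD lt42 lt42) _.
by rewrite -mulr2n -[leLHS]mulr_natl mulfV.
Qed.

End Dist.

Theorem theorem7p2 (R : realType) (n : nat) (hn : (1 <= n)%N)
    (f : 'rV[R]_n -> R) (hf : admissible f) :
  (forall L : UD R n, density L = norm1 (\1_(packing L))) /\
  continuous (fun L : UD_space f => density (UD_set L)) /\
  locally_constant (fun L : UD_space f => density (UD_set L)).
Proof.
(* The radius 1/2 works at every [L], and the symmetry of [D] turns the one-sided comparison into an
   equality. *)
have lc : locally_constant (fun L : UD_space f => density (UD_set L)).
  move=> L; apply/nbhs_ballP; exists 2^-1; first by rewrite /= invr_gt0.
  move=> L' L'L; have DL : (dist_D f (UD_set L) (UD_set L') < (2^-1)%:E)%E := L'L.
  have DL' := DL; rewrite dist_D_sym in DL'.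
  apply/eqP; rewrite eq_le; apply/andP; split.
    exact: (dist_D_lt_half_density_le hf (@UD_prop R n L') (@UD_prop R n L) DL').
  exact: (dist_D_lt_half_density_le hf (@UD_prop R n L) (@UD_prop R n L') DL).
split; first by move=> L; exact: norm1_packing (@UD_prop R n L).
(* Continuity follows from local constancy. *)
split=> // L; exact: cvg_near_cst (lc L).
Qed.
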